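(* In a Cayley-Klein space of dimension $n$ given by $Q_0,A_1,Q_1,\dots,A_r,Q_r,A_{r+1}=\varnothing$ (with $A_0=P^n(\mathbb{R})$), let $Z$ be a point of $P^n(\mathbb{R})$ not in $A_1$. Then the set of all points of $P^n(\mathbb{R})$ lying on tangent lines through $Z$ (lines through $Z$ that are tangent to the absolute figure) is a quadric in $P^n(\mathbb{R})$.
   Context: Conventions. Subspaces are projective subspaces, including $\varnothing$ (of dimension $-1$) and the whole space; $\dim$ is projective dimension; $S+T$ is the smallest subspace containing $S$ and $T$; a point $X$ is identified with $\{X\}$. A hyperplane of a subspace $S$ is a subspace of $S$ of dimension $\dim S-1$. A set of points is independent if representing vectors are linearly independent; a set of hyperplanes is independent if the linear forms defining them are linearly independent. The intersection of the empty family of hyperplanes is the whole space. Quadrics. A quadric $Q$ in a real projective space $P(V)$ is the set $\{[x] : f(x,x)=0\}$ for a symmetric bilinear form $f$ on $V$ that is not identically zero; when polars are taken it is considered together with $f$. Points $[x],[y]$ are conjugate with respect to $Q$ if $f(x,y)=0$. The polar of a subspace $K$ with respect to $Q$ is the set of all points of $P(V)$ conjugate to every point of $K$. The vertex of $Q$ is the polar of $P(V)$; $Q$ is non-degenerate if its vertex is empty. Cayley-Klein space. Put $A_0=P^n(\mathbb{R})$. A Cayley-Klein space of dimension $n$ is $P^n(\mathbb{R})$ with a sequence $Q_0,A_1,Q_1,A_2,\dots,A_r,Q_r,A_{r+1}=\varnothing$ such that, for $0\le i\le r$, $Q_i$ is a quadric in $A_i$ with vertex $A_{i+1}$. Its absolute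 figure is the sequence of complex extensions $\hat Q_0\supseteq\hat A_1\supseteq\hat Q_1\supseteq\cdots\supseteq\hat A_r\supseteq\hat Q_r\supseteq\hat A_{r+1}=\varnothing$. Total polars. If $X$ is a point with $X\in A_l\setminus A_{l+1}$, a total polar of $X$ is a hyperplane of $P^n(\mathbb{R})$ containing $X^{p_l}$ (the polar of $X$ in $A_l$ with respect to $Q_l$). If $K$ is a $k$-dimensional subspace, a total polar of $K$ is an $(n-k-1)$-dimensional subspace of the form $\bigcap_{i=0}^k H_i$, where $\{X_0,\dots,X_k\}$ is some independent subset $B$ of $K$ with $|B\cap A_j|=\dim(K\cap A_j)+1$ for $0\le j\le r$, each $H_i$ is a total polar of $X_i$, and $\{H_0,\dots,H_k\}$ is independent. ($P^n(\mathbb{R})$ and $\varnothing$ are total polar to each other.) Tangency. A subspace $K$ of $P^n(\mathbb{R})$ is tangent to the absolute figure (a tangent subspace) if there exists a total polar $K^\perp$ of $K$ with $K\cap K^\perp\ne\varnothing$. *)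

(* Defs.v *)
From HB Require Import structures.
From mathcomp Require Import all_boot all_order all_algebra.
From mathcomp Require Import classical_sets reals.

Set Implicit Arguments.
Unset Strict Implicit.
Unset Printing Implicit Defensive.

Import GRing.Theory.
Local Open Scope ring_scope.
Local Open Scope classical_set_scope.

(* A projective subspace of P(V) is represented by the vector subspace of V
   that spans it, so that \dim is the projective dimension plus one: the zero
   subspace is the empty projective subspace, and a line has \dim 2. *)

Section Projective.
Variables (R : realType) (V : vectType R).

Record proj_point := ProjPoint {
  point_space :> {vspace V};
  point_dim : \dim point_space = 1%N }.

Definition points (K : {vspace V}) : set proj_point :=
  [set X : proj_point | (X <= K)%VS].

Definition is_line (L : {vspace V}) : Prop := \dim L = 2%N.

Definition is_hyperplane (H : {vspace V}) : Prop := (\dim H).+1 = \dim {:V}.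

Definition independent_points (m : nat) (X : 'I_m -> proj_point) : Prop :=
  exists x : 'I_m -> V,
    (forall i, X i = <[x i]>%VS :> {vspace V}) /\ free [seq x i | i : 'I_m].

Definition independent_hyperplanes (m : nat) (H : 'I_m -> {vspace V}) : Prop :=
  exists phi : 'I_m -> 'Hom(V, R^o),
    (forall i, H i = lker (phi i)) /\ free [seq phi i | i : 'I_m].

(* A quadric in P(A), together with its form. *)
Record quadric (A : {vspace V}) := Quadric {
  qform :> {symmetric (subvs_of A)};
  qform_neq0 : exists x y, qform x y != 0 }.

Definition quadric_points (A : {vspace V}) (Q : quadric A) : set proj_point :=
  [set X : proj_point | exists x : subvs_of A,
     [/\ x != 0, X = <[vsval x]>%VS :> {vspace V} & Q x x = 0]].

Definition conjugate (A : {vspace V}) (Q : quadric A) (X Y : proj_point) : Prop :=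
  exists x y : subvs_of A,
    [/\ X = <[vsval x]>%VS :> {vspace V},
        Y = <[vsval y]>%VS :> {vspace V} & Q x y = 0].

Definition polar (A : {vspace V}) (Q : quadric A) (K : {vspace V}) : set proj_point :=
  [set Y : proj_point | points A Y /\
     forall X : proj_point, points K X -> conjugate Q X Y].

Definition vertex (A : {vspace V}) (Q : quadric A) : set proj_point := polar Q A.

End Projective.

(* The terms ck_A i with i > ck_r.+1 are irrelevant. *)
Record cayley_klein (R : realType) (n : nat) := CayleyKlein {
  ck_r : nat;
  ck_A : nat -> {vspace 'rV[R]_n.+1};
  ck_Q : forall i : 'I_ck_r.+1, quadric (ck_A i);
  ck_A_first : ck_A 0%N = fullv;
  ck_vertex : forall i : 'I_ck_r.+1, vertex (ck_Q i) = points (ck_A i.+1);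
  ck_A_last : ck_A ck_r.+1 = 0%VS }.

Arguments ck_A {R n} C i : rename.
Arguments ck_Q {R n} C i : rename.

Section TotalPolar.
Variables (R : realType) (n : nat) (C : cayley_klein R n).
Notation V := 'rV[R]_n.+1.

Definition point_total_polar (X : proj_point V) (H : {vspace V}) : Prop :=
  is_hyperplane H /\
  exists l : 'I_(ck_r C).+1,
    [/\ points (ck_A C l) X, ~ points (ck_A C l.+1) X
      & polar (ck_Q C l) X `<=` points H].

Definition total_polar (K K' : {vspace V}) : Prop :=
  (\dim K' + \dim K = n.+1)%N /\
  exists (X : 'I_(\dim K) -> proj_point V) (H : 'I_(\dim K) -> {vspace V}),
    [/\ (forall i, points K (X i)) /\ independent_points X,
        forall j, (j <= ck_r C)%N ->
          #|[pred i | (X i <= ck_A C j)%VS]| = \dim (K :&: ck_A C j),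
        forall i, point_total_polar (X i) (H i),
        independent_hyperplanes H
      & K' = (\bigcap_(i < \dim K) H i)%VS].

Definition tangent (K : {vspace V}) : Prop :=
  exists K', total_polar K K' /\ points K `&` points K' !=set0.

End TotalPolar.

(* Main.v *)
Require Import Defs.
From HB Require Import structures.
From mathcomp Require Import all_boot all_order all_algebra.
From mathcomp Require Import ring.
From mathcomp Require Import boolp classical_sets reals.

Set Implicit Arguments.
Unset Strict Implicit.
Unset Printing Implicit Defensive.

Import GRing.Theory Num.Theory.
Local Open Scope ring_scope.
Local Open Scope classical_set_scope.

(* Let [f] be the form of [Q_0], with radical [A_1], and [z] a vector of [Z].
   A line [<z, x>] missing [A_1] has a single total polar, its polar with respect
   to [Q_0], so it is tangent iff [f] degenerates on it. A line meeting [A_1] in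
   a point [w] of level [l] has among its total polars the [z^perp :&: H] with [H] a
   hyperplane through the polar of [w] in [A_l]. If [A_1] has codimension at least
   2, some [H <> z^perp] contains [A_l], hence [w], and the line is tangent; so the
   quadric is [f(z,z) f(x,x) - f(z,x)^2 = 0]. If [A_1] is a hyperplane, then
   [z^perp = A_1] and the line is tangent iff [w] lies on [Q_1] (as it does
   for all [w] in [A_2]); the quadric is the cone over [Q_1] with apex [Z]. When no line
   through [Z] is tangent, the set is empty and a definite form is taken. *)

(** * Linear forms, their kernels, and lines spanned by two vectors *)

Section LinearAlgebra.
Variables (F : fieldType) (V : vectType F).
Implicit Types (a b : 'Hom(V, F^o)) (u v w : V) (U L : {vspace V}).

Lemma free2 (W : vectType F) (u v : W) :
  free [:: u; v] = (u \notin <[v]>)%VS && (v != 0).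
Proof. by rewrite free_cons span_seq1 seq1_free. Qed.

Lemma free2C (W : vectType F) (u v : W) : free [:: u; v] = free [:: v; u].
Proof. by apply: perm_free; rewrite (perm_catC [:: u] [:: v]). Qed.

Lemma dim_lker_form a : a != 0 -> (\dim (lker a)).+1 = \dim {:V}.
Proof.
move=> a0; rewrite -(limg_ker_dim a fullv) capfv -addn1; congr addn.
apply/eqP; rewrite eqn_leq; apply/andP; split.
  rewrite lt0n dimv_eq0; apply: contra a0; rewrite -lkerE => /subvP h.
  apply/eqP/lfunP => v; rewrite zero_lfunE; apply/eqP.
  by rewrite -memv_ker h ?memvf.
by apply: leq_trans (dimvS (subvf _)) _; rewrite dimvf /dim /=.
Qed.

(** If [a v != 0], each [w - (a w / a v) *: v] lies in [lker a], which forces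
    [b = (b v / a v) *: a]. Inclusions of hyperplanes thus become proportionality of forms. *)
Lemma lker_form_subset a b : (lker a <= lker b)%VS -> b \in <[a]>%VS.
Proof.
case: (eqVneq a 0) => [->|a0] sab.
  rewrite memv0; apply/eqP/lfunP => v; rewrite zero_lfunE; apply/eqP.
  by rewrite -memv_ker (subvP sab) // memv_ker zero_lfunE.
have /lfunPn[v] := a0; rewrite zero_lfunE => av0.
apply/vlineP; exists (b v / a v); apply/lfunP => w; rewrite scale_lfunE.
have : w - (a w / a v) *: v \in lker a.
  by rewrite memv_ker linearB linearZ /= [_ *: _]divfK // subrr.
move=> /(subvP sab); rewrite memv_ker linearB linearZ subr_eq0 => /eqP ->.
by rewrite /= [LHS]mulrC mulrA [RHS]mulrAC.
Qed.

(** The restriction of [a] to [lker b] is not zero, since otherwise [a] would be a multiple of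
    [b]. *)
Lemma dim_lker_form_cap a b : free [:: a; b] ->
  (\dim (lker a :&: lker b) + 2)%N = \dim {:V}.
Proof.
rewrite free2 => /andP[ab b0].
rewrite -(dim_lker_form b0) capvC addn2; congr S.
rewrite -(limg_ker_dim a (lker b)) -addn1; congr addn.
apply/eqP; rewrite eq_sym eqn_leq; apply/andP; split.
  by apply: leq_trans (dimvS (subvf _)) _; rewrite dimvf /dim /=.
rewrite lt0n dimv_eq0; apply: contra ab; rewrite -lkerE.
exact: lker_form_subset.
Qed.

(** The map [p = 1 - projv U] kills [U] but not [v]; it is composed with a coordinate that is
    nonzero at [p v]. *)
Lemma exists_separating_form U v : v \notin U ->
  exists2 a : 'Hom(V, F^o), (U <= lker a)%VS & a v != 0.
Proof.
move=> vU; set p := (\1 - projv U)%VF.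
have pv : p v != 0.
  rewrite add_lfunE opp_lfunE id_lfunE subr_eq0.
  by apply: contra vU => /eqP ->; rewrite memv_proj.
case: (pselect (exists i, coord (vbasis {:V}) i (p v) != 0)) => [[i hi]|hn].
  exists (linfun (coord (vbasis {:V}) i : {linear V -> F^o}) \o p)%VF.
    apply/subvP => u uU; rewrite memv_ker comp_lfunE lfunE /=.
    by rewrite add_lfunE opp_lfunE id_lfunE projv_id // subrr linear0.
  by rewrite comp_lfunE lfunE.
case/eqP: pv; rewrite (coord_vbasis (memvf (p v))) big1 // => i _.
have [->|h] := eqVneq (coord (vbasis {:V}) i (p v)) 0; first by rewrite scale0r.
by case: hn; exists i.
Qed.

Lemma memv_line2 u v w : w \in (<[u]> + <[v]>)%VS ->
  exists c d, w = c *: u + d *: v.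
Proof.
by move=> /memv_addP[_ /vlineP[c ->] [_ /vlineP[d ->] ->]]; exists c, d.
Qed.

Lemma line_span L u v : \dim L = 2%N -> u \in L -> v \in L ->
  free [:: u; v] -> L = (<[u]> + <[v]>)%VS.
Proof.
move=> dL uL vL fr; have bas : basis_of L [:: u; v].
  by rewrite basisEfree fr dL /= andbT; apply/span_subvP => w; rewrite !inE => /orP[]/eqP->.
by rewrite -(span_basis bas) span_cons span_seq1.
Qed.

Lemma dim_line2 u v : free [:: u; v] -> \dim (<[u]> + <[v]>)%VS = 2%N.
Proof. by move=> /eqP; rewrite span_cons span_seq1. Qed.

End LinearAlgebra.

(** * Points, polars and vertices in terms of representing vectors *)

Section Polars.
Variables (R : realType) (V : vectType R).
Implicit Types (u v w : V) (A K : {vspace V}) (X Y : proj_point V).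

Lemma proj_point_line X : exists2 v, v != 0 & X = <[v]>%VS :> {vspace V}.
Proof.
exists (vpick X); first by rewrite vpick0 -dimv_eq0 point_dim.
apply/eqP; rewrite eq_sym eqEdim -memvE memv_pick point_dim dim_vline lt0b.
by rewrite vpick0 -dimv_eq0 point_dim.
Qed.

Lemma line_proj_point v : v != 0 -> exists X, X = <[v]>%VS :> {vspace V}.
Proof.
by move=> v0; have h : \dim <[v]>%VS = 1%N; [rewrite dim_vline v0 | exists (ProjPoint h)].
Qed.

Lemma points_line K X v : X = <[v]>%VS :> {vspace V} -> points K X <-> v \in K.
Proof. by rewrite /points /= => ->. Qed.

Lemma points_subset A K : points A `<=` points K -> (A <= K)%VS.
Proof.
move=> sAK; apply/subvP => v vA.
have [->|v0] := eqVneq v 0; first exact: mem0v.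
have [X hX] := line_proj_point v0.
by apply/(points_line _ hX); apply: sAK; apply/(points_line _ hX).
Qed.

Lemma eq_proj_point X Y : (X <= Y)%VS -> X = Y.
Proof.
case: X Y => [X dX] [Y dY] /= sXY.
have /eqP e : X == Y by rewrite eqEdim sXY dX dY.
by subst Y; congr ProjPoint; apply: eq_irrelevance.
Qed.

Variables (A : {vspace V}) (Q : quadric A).

(** Projecting to [A] first extends the form to all of [V], so that polars at different levels
    become kernels of linear forms on one space. The values are meaningful only for vectors of
    [A]. *)
Definition polar_map u : 'Hom(V, R^o) :=
  linfun ((Q (vsproj A u) : {linear _ -> R^o}) \o vsproj A).

Lemma polar_mapE u v : polar_map u v = Q (vsproj A u) (vsproj A v).
Proof. by rewrite lfunE. Qed.

Lemma polar_mapC u v : polar_map u v = polar_map v u.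
Proof. by rewrite !polar_mapE hermC expr0 mul1r. Qed.

Lemma polar_mapD u v : polar_map (u + v) = polar_map u + polar_map v.
Proof. by apply/lfunP => w; rewrite add_lfunE ![_ _ w]polar_mapC linearD. Qed.

Lemma polar_mapZ c u : polar_map (c *: u) = c *: polar_map u.
Proof. by apply/lfunP => w; rewrite scale_lfunE ![_ _ w]polar_mapC linearZ. Qed.

Lemma conjugate_line X Y u v : X = <[u]>%VS :> {vspace V} ->
  Y = <[v]>%VS :> {vspace V} ->
  conjugate Q X Y <-> [/\ u \in A, v \in A & polar_map u v = 0].
Proof.
move=> hX hY; split=> [[x [y [hx hy xy]]]|[uA vA uv]]; last first.
  by exists (vsproj A u), (vsproj A v); rewrite !vsprojK // -polar_mapE.
have /vlineP[c ->] : u \in <[vsval x]>%VS by rewrite -hx hX memv_line.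
have /vlineP[d ->] : v \in <[vsval y]>%VS by rewrite -hy hY memv_line.
split; rewrite ?memvZ ?subvsP //.
by rewrite linearZ /= polar_mapZ scale_lfunE polar_mapE !vsvalK xy !scaler0.
Qed.

Lemma polar_point X u : X = <[u]>%VS :> {vspace V} -> u \in A ->
  polar Q X = points (A :&: lker (polar_map u)).
Proof.
move=> hX uA; apply/predeqP => Y; have [v v0 hY] := proj_point_line Y.
rewrite (points_line _ hY) memv_cap memv_ker; split.
  by case=> _ /(_ X (subvv _)) /(conjugate_line hX hY)[_ -> ->] /=.
case/andP=> vA /eqP uv; split; first exact/(points_line _ hY).
by move=> X' /eq_proj_point ->; apply/(conjugate_line hX hY).
Qed.

(** Turns an equality of point sets into a condition on vectors; the zero vector represents no point
    and is treated apart. *)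
Lemma mem_vertex K v : vertex Q = points K ->
  v \in K <-> v \in A /\ forall u, u \in A -> polar_map u v = 0.
Proof.
move=> hK; have [->|v0] := eqVneq v 0.
  by split=> _; [split=> [|u _]; rewrite ?linear0 ?mem0v | exact: mem0v].
have [Y hY] := line_proj_point v0; rewrite -(points_line _ hY) -hK.
split=> [[/(points_line _ hY) vA h]|[vA h]].
  split=> // u uA; have [->|u0] := eqVneq u 0.
    by rewrite polar_mapC linear0.
  have [X hX] := line_proj_point u0.
  by have /(conjugate_line hX hY)[] := h X ((points_line A hX).2 uA).
split; first exact/(points_line _ hY).
move=> X; have [u u0 hX] := proj_point_line X => /(points_line _ hX) uA.
by apply/(conjugate_line hX hY); split=> //; apply: h.
Qed.

End Polars.

(** * Quadrics from symmetric bilinear maps *)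

Section QuadricOfForm.
Variables (R : realType) (V : vectType R) (b : V -> 'Hom(V, R^o)).
Hypothesis bC : forall x y, b x y = b y x.

Definition subvs_form (x y : subvs_of {:V}) : R := b (vsval x) (vsval y).

Fact subvs_form_bilinear : bilinear_for *%R (idfun \; *%R) subvs_form.
Proof. by split=> [y c u v|x c u v]; rewrite /subvs_form ?[b _ (vsval y)]bC linearP. Qed.

Fact subvs_form_sym x y :
  subvs_form x y = (-1) ^+ false * idfun (subvs_form y x).
Proof. by rewrite expr0 mul1r [LHS]bC. Qed.

HB.instance Definition _ :=
  bilinear_isBilinear.Build R _ _ _ _ _ subvs_form subvs_form_bilinear.
HB.instance Definition _ :=
  isHermitianSesquilinear.Build R _ _ _ subvs_form subvs_form_sym.

Lemma quadric_of_form : (exists x y, b x y != 0) ->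
  exists Q : quadric {:V}, forall (X : proj_point V) x,
    X = <[x]>%VS :> {vspace V} -> quadric_points Q X <-> b x x = 0.
Proof.
move=> [x0 [y0 b0]].
have n0 : exists x y, (subvs_form : {symmetric _}) x y != 0.
  by exists (vsproj _ x0), (vsproj _ y0); rewrite /= /subvs_form !vsprojK ?memvf.
exists (Quadric n0) => X x hX; split=> [[y [_ hy /= bxx]]|bxx].
  have /vlineP[c ->] : x \in <[vsval y]>%VS by rewrite -hy hX memv_line.
  by rewrite linearZ /= bC linearZ /= [b _ _]bxx !scaler0.
exists (vsproj _ x); rewrite /= /subvs_form vsprojK ?memvf //; split=> //.
apply/eqP => /(congr1 vsval); rewrite vsprojK ?memvf //= => x00.
by have := point_dim X; rewrite hX x00 dimv0.
Qed.

End QuadricOfForm.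

(** Take the sum of squares of the coordinates in a basis; over the reals it vanishes only at 0. *)
Lemma exists_definite_form (R : realType) (V : vectType R) :
  exists b : V -> 'Hom(V, R^o), (forall x y, b x y = b y x) /\
    forall x, b x x = 0 -> x = 0.
Proof.
pose co i : 'Hom(V, R^o) := linfun (coord (vbasis {:V}) i : {linear V -> R^o}).
exists (fun x => \sum_i coord (vbasis {:V}) i x *: co i); split=> [x y|x].
  rewrite !sum_lfunE; apply: eq_bigr => i _.
  by rewrite !scale_lfunE !lfunE /= [LHS]mulrC.
rewrite sum_lfunE => /eqP; rewrite psumr_eq0; last first.
  by move=> i _; rewrite scale_lfunE lfunE; apply: sqr_ge0.
move=> /allP h; rewrite (coord_vbasis (memvf x)) big1 // => i _.
have := h i (mem_index_enum _); rewrite scale_lfunE lfunE /= mulf_eq0 orbb.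
by move=> /eqP ->; rewrite scale0r.
Qed.

(** * The flag of a Cayley-Klein space and total polars of points *)

Section CayleyKleinLines.
Variables (R : realType) (n : nat) (C : cayley_klein R n).
Notation V := 'rV[R]_n.+1.
Notation form l := (polar_map (ck_Q C l)).
Implicit Types (u v w x y z : V) (K L P : {vspace V}) (X : proj_point V)
  (a : 'Hom(V, R^o)).

Lemma mem_ckS (i : 'I_(ck_r C).+1) v :
  v \in ck_A C i.+1 <-> v \in ck_A C i /\ forall u, u \in ck_A C i -> form i u v = 0.
Proof. exact: mem_vertex (ck_vertex i). Qed.

Lemma ck_A_subset i j : (i <= j <= (ck_r C).+1)%N -> (ck_A C j <= ck_A C i)%VS.
Proof.
elim: j => [|j IH]; first by rewrite leqn0 => /andP[/eqP ->].
rewrite leq_eqVlt ltnS => /andP[/orP[/eqP <- //|ij] jr].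
apply: (@subv_trans _ _ (ck_A C j)); last by apply: IH; rewrite ij ltnW.
by apply/subvP => v /(mem_ckS (Ordinal jr))[].
Qed.

(** The least index [i] with [v] outside [A_i] is positive because [A_0] is everything and at most
    [r + 1] because [A_(r+1)] is zero; the level is its predecessor. *)
Lemma ck_level v : v != 0 ->
  exists l : 'I_(ck_r C).+1, v \in ck_A C l /\ v \notin ck_A C l.+1.
Proof.
move=> v0; have ex : exists i, v \notin ck_A C i.
  by exists (ck_r C).+1; rewrite ck_A_last memv0.
case: (ex_minnP ex) => -[|l] hl hmin; first by rewrite ck_A_first memvf in hl.
have lr : (l < (ck_r C).+1)%N.
  by apply: hmin; rewrite ck_A_last memv0.
exists (Ordinal lr); split=> //=; apply/negbNE/negP => h.
by have := hmin _ h; rewrite ltnn.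
Qed.

(** A hyperplane is handled through a linear form [a] defining it; the condition [a != 0] is
    supplied separately. *)
Definition total_polar_form x (a : 'Hom(V, R^o)) : Prop :=
  exists l : 'I_(ck_r C).+1, [/\ x \in ck_A C l, x \notin ck_A C l.+1
    & (ck_A C l :&: lker (form l x) <= lker a)%VS].

Lemma point_total_polar_form X x a : X = <[x]>%VS :> {vspace V} -> a != 0 ->
  point_total_polar C X (lker a) <-> total_polar_form x a.
Proof.
move=> hX a0; split=> [[_ [l [/(points_line _ hX) xl]]]|[l [xl xl' s]]].
  move=> /(points_line _ hX)/negP xl'; rewrite (polar_point _ hX xl).
  by move=> /points_subset s; exists l.
split; first exact: dim_lker_form; exists l; split.
- exact/(points_line _ hX).
- by move=> /(points_line _ hX); apply/negP.
- by rewrite (polar_point _ hX xl) => Y sY; apply: subv_trans sY s.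
Qed.

(** The index types in [total_polar] depend on [\dim K]; abstracting the dimension lets lines be
    indexed by ['I_2] without casts. *)
Lemma total_polar_dim m K K' : \dim K = m ->
  total_polar C K K' <-> (\dim K' + m = n.+1)%N /\
  exists (X : 'I_m -> proj_point V) (H : 'I_m -> {vspace V}),
    [/\ (forall i, points K (X i)) /\ independent_points X,
        forall j, (j <= ck_r C)%N ->
          #|[pred i | (X i <= ck_A C j)%VS]| = \dim (K :&: ck_A C j),
        forall i, point_total_polar C (X i) (H i),
        independent_hyperplanes H
      & K' = (\bigcap_(i < m) H i)%VS].
Proof. by move=> <-. Qed.

(** * Tangent lines described by pairs of vectors and pairs of forms *)

Lemma map_ord2 (T : Type) (g : 'I_2 -> T) :
  [seq g i | i : 'I_2] = [:: g ord0; g ord_max].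
Proof.
rewrite /image_mem enum_ordSl enum_ordSl enum_ord0 /=.
by congr [:: _; g _]; apply: val_inj.
Qed.

Lemma card_pred_ord2 (p : pred 'I_2) : #|p| = (p ord0 + p ord_max)%N.
Proof.
rewrite -sum1_card big_mkcond big_ord_recl big_ord1 /=.
have -> : lift ord0 ord0 = ord_max :> 'I_2 by apply: val_inj.
by rewrite !unfold_in; case: (p ord0); case: (p ord_max).
Qed.

Lemma bigcap_ord2 (H : 'I_2 -> {vspace V}) :
  (\bigcap_(i < 2) H i)%VS = (H ord0 :&: H ord_max)%VS.
Proof.
rewrite big_ord_recl big_ord1; congr (_ :&: H _)%VS; exact: val_inj.
Qed.

Lemma ord2P (p : 'I_2 -> Prop) : p ord0 -> p ord_max -> forall i, p i.
Proof.
move=> p0 p1 [[|[|//]] hi]; first by rewrite (_ : Ordinal hi = ord0) //; apply: val_inj.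
by rewrite (_ : Ordinal hi = ord_max) //; apply: val_inj.
Qed.

(** Vectors [x0], [x1] stand for the basis points, forms [a0], [a1] for the hyperplanes, and [y] for
    a common point of the line and its total polar. The dimension of the total polar follows from
    the independence of the forms. *)
Lemma tangent_lineP L : is_line L -> tangent C L <->
  exists x0 x1 a0 a1,
    [/\ free [:: x0; x1], x0 \in L, x1 \in L & forall j, (j <= ck_r C)%N ->
          ((x0 \in ck_A C j) + (x1 \in ck_A C j))%N = \dim (L :&: ck_A C j)]
    /\ [/\ total_polar_form x0 a0, total_polar_form x1 a1, free [:: a0; a1]
         & exists y, [/\ y != 0, y \in L, a0 y = 0 & a1 y = 0]].
Proof.
move=> dL; split.
  move=> [K' [/(total_polar_dim _ dL)[_ [X [H]]]]].
  move=> [[XL [x [hX frx]]] card pol [a [hH fra]] ->] [Y [YL YK]].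
  rewrite map_ord2 in frx; rewrite map_ord2 in fra.
  have an0 i : a i != 0.
    by move: i; apply: ord2P; apply: (free_not0 fra); rewrite !inE eqxx ?orbT.
  exists (x ord0), (x ord_max), (a ord0), (a ord_max); split; split=> //.
  - exact/(points_line _ (hX _)).
  - exact/(points_line _ (hX _)).
  - move=> j jr; rewrite -card // card_pred_ord2 /=.
    by rewrite !hX.
  - by apply/(point_total_polar_form (hX _) (an0 _)); rewrite -hH.
  - by apply/(point_total_polar_form (hX _) (an0 _)); rewrite -hH.
  - have [y y0 hY] := proj_point_line Y; exists y.
    move: YL YK => /(points_line _ hY) yL /(points_line _ hY).
    by rewrite bigcap_ord2 memv_cap !hH !memv_ker => /andP[/eqP ? /eqP ?].
move=> [x0 [x1 [a0 [a1 [[frx x0L x1L card] [pol0 pol1 fra [y [y0 yL a0y a1y]]]]]]]].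
have [/andP[_ x1n] /andP[_ a1n]] : (x0 \notin <[x1]>%VS) && (x1 != 0) /\
    (a0 \notin <[a1]>%VS) && (a1 != 0) by rewrite -!free2.
have x0n := free_not0 frx (mem_head _ _); have a0n := free_not0 fra (mem_head _ _).
have [X0 hX0] := line_proj_point x0n; have [X1 hX1] := line_proj_point x1n.
exists (lker a0 :&: lker a1)%VS; split; last first.
  have [Y hY] := line_proj_point y0; exists Y.
  by split; apply/(points_line _ hY); rewrite ?memv_cap ?memv_ker ?a0y ?a1y ?eqxx.
apply/(total_polar_dim _ dL); split.
  by rewrite dim_lker_form_cap // dimvf /dim /= mul1n.
pose ch (T : Type) (s t : T) (i : 'I_2) := if i == ord0 then s else t.
exists (ch _ X0 X1), (ch _ (lker a0) (lker a1)); split.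
- split; first by apply: ord2P; [apply/(points_line _ hX0) | apply/(points_line _ hX1)].
  by exists (ch _ x0 x1); split; [apply: ord2P | rewrite map_ord2].
- by move=> j jr; rewrite -card // card_pred_ord2 /ch /= hX0 hX1.
- apply: ord2P; rewrite /ch /=.
    exact/(point_total_polar_form hX0).
  exact/(point_total_polar_form hX1).
- by exists (ch _ a0 a1); split; [apply: ord2P | rewrite map_ord2].
- by rewrite bigcap_ord2.
Qed.


(** * Levels of points and the form of [Q_0] *)

Lemma ck_A_proper (i : 'I_(ck_r C).+1) : (\dim (ck_A C i.+1) < \dim (ck_A C i))%N.
Proof.
have s : (ck_A C i.+1 <= ck_A C i)%VS by apply: ck_A_subset; rewrite leqnSn /=.
rewrite (ltn_leqif (dimv_leqif_sup s)); apply/negP => /subvP s'.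
have [x [y /eqP[]]] := qform_neq0 (ck_Q C i).
have /mem_ckS[_ /(_ _ (subvsP x))] := s' _ (subvsP y).
by rewrite polar_mapE !vsvalK.
Qed.

Lemma ck_level_uniq (i j : 'I_(ck_r C).+1) v :
  v \in ck_A C i -> v \notin ck_A C i.+1 ->
  v \in ck_A C j -> v \notin ck_A C j.+1 -> i = j.
Proof.
have aux (k l : 'I_(ck_r C).+1) :
    v \notin ck_A C k.+1 -> v \in ck_A C l -> (l <= k)%N.
  move=> vk vl; rewrite leqNgt; apply: contra vk => kl.
  by apply: (subvP (ck_A_subset _) _ vl); rewrite kl ltnW.
by move=> vi vi' vj vj'; apply/val_inj/eqP; rewrite eqn_leq !aux.
Qed.

Lemma mem_ck1 v : v \in ck_A C 1 <-> forall u, form ord0 u v = 0.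
Proof.
have A0 x : x \in ck_A C (ord0 : 'I_(ck_r C).+1) by rewrite /= ck_A_first memvf.
by rewrite (mem_ckS ord0); split=> [[_ h] u|h]; [apply: h | split].
Qed.

Lemma form0_neq0 v : v \notin ck_A C 1 -> form ord0 v != 0.
Proof.
apply: contra => /eqP v0; apply/mem_ck1 => u.
by rewrite polar_mapC v0 zero_lfunE.
Qed.

Lemma ck1_subset_lker v : (ck_A C 1 <= lker (form ord0 v))%VS.
Proof. by apply/subvP => w /mem_ck1 h; rewrite memv_ker h. Qed.

(** A point outside [A_1] has level 0, where its polar is already a hyperplane; so its total polar
    is unique. *)
Lemma total_polar_form0 x a : x \notin ck_A C 1 ->
  total_polar_form x a <-> (lker (form ord0 x) <= lker a)%VS.
Proof.
move=> x1; have x0 : x \in ck_A C (ord0 : 'I_(ck_r C).+1).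
  by rewrite /= ck_A_first memvf.
split=> [[l [xl xl' s]]|s]; last by exists ord0; split=> //; rewrite /= {1}ck_A_first capfv.
have e : l = ord0 by apply: ck_level_uniq xl xl' x0 x1.
by move: s; rewrite e /= {1}ck_A_first capfv.
Qed.

(** * Intersections of lines with the flag, and lines missing [A_1] *)

Lemma dim_line_cap w U : \dim (<[w]> :&: U) = ((w != 0) && (w \in U)) :> nat.
Proof.
case wU: (w \in U).
  by have /capv_idPl -> : (<[w]> <= U)%VS by []; rewrite dim_vline andbT.
rewrite andbF; apply/eqP; rewrite dimv_eq0 -subv0; apply/subvP => v.
rewrite memv_cap => /andP[/vlineP[c ->]]; have [->|c0] := eqVneq c 0.
  by move=> _; rewrite scale0r mem0v.
by move=> /(memvZ c^-1); rewrite scalerA mulVf // scale1r wU.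
Qed.

Lemma dim_line_cap_ck L w j : (L :&: ck_A C 1 = <[w]>)%VS ->
  (0 < j <= ck_r C)%N -> \dim (L :&: ck_A C j) = ((w != 0) && (w \in ck_A C j)) :> nat.
Proof.
move=> hw /andP[j0 jr]; rewrite -dim_line_cap -hw -capvA; congr (\dim (L :&: _)%VS).
by apply/esym/capv_idPr/ck_A_subset; rewrite j0 leqW.
Qed.

(** The expression is the Gram determinant of [u] and [v], which detects a radical of the form on
    their span. *)
Lemma gram_degenerate u v : free [:: u; v] ->
  (exists y, [/\ y != 0, y \in (<[u]> + <[v]>)%VS, form ord0 u y = 0 & form ord0 v y = 0])
  <-> form ord0 u u * form ord0 v v - form ord0 u v ^+ 2 = 0.
Proof.
move=> fr; split=> [[y [y0 /memv_line2[c [d hy]]]]|det].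
  rewrite hy => e1 e2; rewrite !linearD !linearZ /= [form ord0 v u]polar_mapC in e1 e2.
  set p := form ord0 u u in e1 *; set q := form ord0 u v in e1 e2 *.
  set s := form ord0 v v in e2 *.
  (* Cramer's rule: the determinant annihilates both coordinates of [y]. *)
  have c0 : c * (p * s - q ^+ 2) = 0.
    transitivity (s * (c * p + d * q) - q * (c * q + d * s)); first by ring.
    by rewrite [c * p + _]e1 [c * q + _]e2 !mulr0 subr0.
  have d0 : d * (p * s - q ^+ 2) = 0.
    transitivity (p * (c * q + d * s) - q * (c * p + d * q)); first by ring.
    by rewrite [c * p + _]e1 [c * q + _]e2 !mulr0 subr0.
  have [e|D0] := eqVneq (p * s - q ^+ 2) 0; first by [].
  move/eqP: c0; rewrite mulf_eq0 (negbTE D0) orbF => /eqP c0.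
  move/eqP: d0; rewrite mulf_eq0 (negbTE D0) orbF => /eqP d0.
  by rewrite hy c0 d0 !scale0r addr0 eqxx in y0.
have nz c d : c *: u + d *: v = 0 -> d = 0.
  move=> e; apply/eqP; apply: contraT => d0; move: fr.
  rewrite free2C free2 => /andP[/negP[]]; apply/vlineP; exists (- c / d).
  rewrite [LHS](_ : _ = d^-1 *: (d *: v)); last by rewrite scalerA mulVf ?scale1r.
  by rewrite -[d *: v](addKr (c *: u)) e addr0 -scaleNr scalerA mulrC.
have [u0 uv] : u != 0 /\ u \in (<[u]> + <[v]>)%VS.
  by rewrite (free_not0 fr (mem_head _ _)) (subvP (addvSl _ _)) ?memv_line.
have vv : v \in (<[u]> + <[v]>)%VS by rewrite (subvP (addvSr _ _)) ?memv_line.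
(* If [u] is isotropic, the zero determinant makes it conjugate to [v] too, so [u] itself serves. *)
case: (eqVneq (form ord0 u u) 0) => [p0|p0].
  move: det; rewrite p0 mul0r sub0r => /eqP; rewrite oppr_eq0 expf_eq0 /= => /eqP q0.
  by exists u; split=> //; rewrite polar_mapC.
(* This combination is conjugate to [u] identically, and its product with [v] is minus the
   determinant. *)
exists (form ord0 u v *: u + - form ord0 u u *: v); split.
- by apply: contra p0 => /eqP/nz/eqP; rewrite oppr_eq0.
- by rewrite memvD ?memvZ.
- by rewrite linearD !linearZ /= !/(_ *: _) /= mulNr [X in X - _]mulrC subrr.
- rewrite linearD !linearZ /= [form ord0 v u]polar_mapC; apply/eqP.
  by rewrite -oppr_eq0 -det; apply/eqP; rewrite /GRing.scale /=; ring.
Qed.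

(** All points of the line have unique total polars, so the only total polar of the line is its
    polar in [Q_0]. *)
Lemma tangent_gram u v : free [:: u; v] ->
  ((<[u]> + <[v]>) :&: ck_A C 1 = 0)%VS ->
  tangent C (<[u]> + <[v]>)%VS <->
  form ord0 u u * form ord0 v v - form ord0 u v ^+ 2 = 0.
Proof.
move=> fr hL; set L := (_ + _)%VS in hL *.
have dL : is_line L by exact: dim_line2.
have LA x : x \in L -> x != 0 -> x \notin ck_A C 1.
  move=> xL x0; apply: contra x0 => xA.
  by rewrite -memv0 -hL memv_cap xL.
have uL : u \in L by rewrite (subvP (addvSl _ _)) ?memv_line.
have vL : v \in L by rewrite (subvP (addvSr _ _)) ?memv_line.
have u0 := free_not0 fr (mem_head _ _).
have /andP[uv v0] : (u \notin <[v]>%VS) && (v != 0) by rewrite -free2.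
rewrite -(gram_degenerate fr) (tangent_lineP dL); split.
  move=> [x0 [x1 [a0 [a1 [[frx x0L x1L _] [pol0 pol1 fra [y [y0 yL a0y a1y]]]]]]]].
  have aux x a : x \in L -> x != 0 -> a != 0 -> total_polar_form x a -> a y = 0 ->
      form ord0 x y = 0.
    move=> xL xn0 an0 /(total_polar_form0 _ (LA _ xL xn0)) /lker_form_subset.
    move=> /vlineP[c e]; rewrite e scale_lfunE => /eqP.
    rewrite scaler_eq0 => /orP[/eqP c0|/eqP //].
    by rewrite e c0 scale0r eqxx in an0.
  have y0x : form ord0 x0 y = 0.
    by apply: aux pol0 a0y => //; [apply: free_not0 frx _|apply: free_not0 fra _]; rewrite mem_head.
  have y1x : form ord0 x1 y = 0.
    by apply: aux pol1 a1y => //; [apply: free_not0 frx _|apply: free_not0 fra _]; rewrite !inE eqxx orbT.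
  (* The basis [x0], [x1] need not be [u], [v], but it spans the same line. *)
  have all x : x \in L -> form ord0 x y = 0.
    rewrite (line_span dL x0L x1L frx) => /memv_line2[c [d ->]].
    by rewrite polar_mapD !polar_mapZ add_lfunE !scale_lfunE y0x y1x !scaler0 addr0.
  by exists y; split=> //; apply: all.
move=> [y [y0 yL uy vy]]; exists u, v, (form ord0 u), (form ord0 v); split; split=> //.
- move=> [|j] jr; first by rewrite ck_A_first !memvf capvf dL.
  rewrite (dim_line_cap_ck hL) ?jr // eqxx /=.
  have notA x : x \in L -> x != 0 -> x \in ck_A C j.+1 = false.
    move=> xL x0; apply/negbTE; apply: contra (LA _ xL x0) => xA.
    by apply: (subvP (ck_A_subset _) _ xA); exact: leqW.
  by rewrite !notA.
- by apply/(total_polar_form0 _ (LA _ uL u0)).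
- by apply/(total_polar_form0 _ (LA _ vL v0)).
(* Dependence of the two polars would put [u - c *: v] in the radical [A_1], which the line
   misses. *)
- rewrite free2 form0_neq0 ?LA // andbT; apply: contra uv => /vlineP[c e].
  have : u - c *: v \in ck_A C 1.
    apply/mem_ck1 => w; rewrite polar_mapC polar_mapD -scaleNr polar_mapZ e.
    by rewrite scaleNr subrr zero_lfunE.
  move=> h; have : u - c *: v \in (L :&: ck_A C 1)%VS by rewrite memv_cap h memvB ?memvZ.
  by rewrite hL memv0 subr_eq0 => /eqP ->; rewrite memvZ ?memv_line.
- by exists y.
Qed.

(** * Lines joining a point outside [A_1] to a point of [A_1] *)

Lemma line_cap_ck1 z w : z \notin ck_A C 1 -> w \in ck_A C 1 ->
  ((<[z]> + <[w]>) :&: ck_A C 1 = <[w]>)%VS.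
Proof.
move=> zA wA; apply/eqP; rewrite eqEsubv subv_cap addvSr -memvE wA !andbT.
apply/subvP => x; rewrite memv_cap => /andP[/memv_line2[c [d ->]] h].
have : c *: z \in ck_A C 1 by rewrite -[c *: z](addrK (d *: w)) memvB ?memvZ.
have [->|c0] := eqVneq c 0; first by rewrite scale0r add0r memvZ ?memv_line.
by move=> /(memvZ c^-1); rewrite scalerA mulVf // scale1r (negbTE zA).
Qed.

Lemma free_ck1 z w : z \notin ck_A C 1 -> w \in ck_A C 1 -> w != 0 -> free [:: z; w].
Proof.
move=> zA wA w0; rewrite free2 w0 andbT; apply: contra zA => /vlineP[c ->].
by rewrite memvZ.
Qed.

(** As [\dim P < n], the polar hyperplane of [z] is not inside [P], so some form vanishes on [P] and
    is independent of [form ord0 z]. Both kernels contain [w], which lies in the radical [A_1] and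
    in [P]. *)
Lemma tangent_of_subspace z w P (l : 'I_(ck_r C).+1) :
  z \notin ck_A C 1 -> w \in ck_A C 1 -> w != 0 ->
  w \in ck_A C l -> w \notin ck_A C l.+1 ->
  w \in P -> (ck_A C l :&: lker (form l w) <= P)%VS -> (\dim P < n)%N ->
  tangent C (<[z]> + <[w]>)%VS.
Proof.
move=> zA wA w0 wl wl' wP sP dP.
have fr := free_ck1 zA wA w0; have dL := dim_line2 fr.
have zn := form0_neq0 zA.
have /subvPn[v vk vP] : ~~ (lker (form ord0 z) <= P)%VS.
  apply/negP => /dimvS; have := dim_lker_form zn.
  rewrite dimvf /dim /= mul1n => -[->]; by rewrite leqNgt dP.
have [a Pa av] := exists_separating_form vP.
apply/(tangent_lineP dL); exists z, w, (form ord0 z), a; split; split=> //.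
- by rewrite (subvP (addvSl _ _)) ?memv_line.
- by rewrite (subvP (addvSr _ _)) ?memv_line.
- move=> [|j] jr; first by rewrite ck_A_first !memvf capvf dL.
  rewrite (dim_line_cap_ck (line_cap_ck1 zA wA)) ?jr // w0 /=.
  rewrite [z \in _](_ : _ = false) //; apply/negbTE; apply: contra zA => zA.
  by apply: (subvP (ck_A_subset _) _ zA); exact: leqW.
- exact/total_polar_form0.
- by exists l; split=> //; apply: subv_trans Pa.
- rewrite free2; apply/andP; split; last by apply: contra av => /eqP ->; rewrite zero_lfunE.
  apply/negP => /vlineP[c e]; move: vk; rewrite memv_ker e scale_lfunE scaler_eq0.
  by rewrite (negbTE av) orbF => /eqP c0; rewrite e c0 scale0r eqxx in zn.
- exists w; split=> //; first by rewrite (subvP (addvSr _ _)) ?memv_line.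
    by move/mem_ck1: wA; apply.
  by apply/eqP; rewrite -memv_ker (subvP Pa).
Qed.

Lemma tangent_small_ck1 z w : (\dim (ck_A C 1) < n)%N ->
  z \notin ck_A C 1 -> w \in ck_A C 1 -> w != 0 -> tangent C (<[z]> + <[w]>)%VS.
Proof.
move=> dA zA wA w0; have [l [wl wl']] := ck_level w0.
apply: (@tangent_of_subspace z w (ck_A C l) l) => //; first exact: capvSl.
apply: leq_ltn_trans dA; apply/dimvS/ck_A_subset.
rewrite lt0n ltnW ?ltn_ord // andbT; apply/eqP => l0.
by move: wl'; rewrite l0 wA.
Qed.

(** The hyperplane [A_1] is the polar of every point outside it, so only the choice of a total polar
    of [w] matters. *)
Lemma tangent_big_ck1 z w (l1 : 'I_(ck_r C).+1) : l1 = 1%N :> nat ->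
  \dim (ck_A C 1) = n -> z \notin ck_A C 1 -> w \in ck_A C 1 -> w != 0 ->
  tangent C (<[z]> + <[w]>)%VS <-> form l1 w w = 0.
Proof.
move=> hl dA zA wA w0; have wA1 : w \in ck_A C l1 by rewrite hl.
have dA1 : \dim (ck_A C l1) = n by rewrite hl.
have hL := line_cap_ck1 zA wA; have dL := dim_line2 (free_ck1 zA wA w0).
split; last first.
  move=> ww; have [w2|w2] := boolP (w \in ck_A C l1.+1).
    have [l [wl wl']] := ck_level w0.
    (* Here [l] is at least 2, so [A_l] lies in [A_2], a proper subspace of [A_1]. *)
    apply: (@tangent_of_subspace z w (ck_A C l) l) => //; first exact: capvSl.
    have : (\dim (ck_A C l1.+1) < n)%N by rewrite -[X in (_ < X)%N]dA1 ck_A_proper.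
    apply: leq_ltn_trans; apply/dimvS/ck_A_subset.
    rewrite (ltnW (ltn_ord l)) andbT ltnNge; apply: contra wl' => ll1.
    by apply: (subvP (ck_A_subset _) _ w2); rewrite ltnS ll1 ltn_ord.
  (* The polar of [w] in [A_1] contains [w] because [w] is on [Q_1], and is proper because [w] is
     not in the vertex [A_2]. *)
  apply: (@tangent_of_subspace z w (ck_A C l1 :&: lker (form l1 w))%VS l1) => //.
    by rewrite memv_cap wA1 memv_ker ww eqxx.
  rewrite -[X in (_ < X)%N]dA1 (ltn_leqif (dimv_leqif_sup (capvSl _ _))).
  apply: contra w2 => s; apply/mem_ckS; split=> // u /(subvP s).
  by rewrite memv_cap memv_ker => /andP[_ /eqP]; rewrite polar_mapC.
have [w2 _|w2] := boolP (w \in ck_A C l1.+1).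
  by have /mem_ckS[_] := w2; apply.
(* Stated for a basis whose second vector lies in [A_1]; the given basis may come in either
   order. *)
have key x0 x1 a0 a1 y : x0 \notin ck_A C 1 -> x1 \in ck_A C 1 -> x1 != 0 ->
    x1 \in (<[z]> + <[w]>)%VS -> total_polar_form x0 a0 -> total_polar_form x1 a1 ->
    free [:: a1; a0] -> y != 0 -> y \in (<[z]> + <[w]>)%VS -> a0 y = 0 -> a1 y = 0 ->
    form l1 w w = 0.
  move=> x0A x1A x1n x1L /(total_polar_form0 _ x0A) pol0 pol1 fra y0 yL a0y a1y.
  have : x1 \in <[w]>%VS by rewrite -hL memv_cap x1L.
  move=> /vlineP[c x1E]; have c0 : c != 0.
    by apply: contra x1n => /eqP c0; rewrite x1E c0 scale0r.
  have Aw : <[w]>%VS = <[x1]>%VS.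
    apply/eqP; rewrite eq_sym eqEdim -memvE x1E memvZ ?memv_line //= !dim_vline.
    by rewrite w0 -x1E x1n.
  move: fra; rewrite free2 => /andP[/negP fra a0n].
  have A0 : ck_A C 1 = lker a0.
    apply/eqP; rewrite eqEdim (subv_trans (ck1_subset_lker x0) pol0) /=.
    have := dim_lker_form a0n; rewrite dimvf /dim /= mul1n => -[->].
    by rewrite dA.
  (* The vector [y] lies on the line and in [lker a0], which is [A_1], so it represents the same
     point as [x1]. *)
  have a1x1 : a1 x1 = 0.
    have : y \in <[x1]>%VS by rewrite -Aw -hL memv_cap yL A0 memv_ker a0y eqxx.
    move=> /vlineP[d yE]; move: a1y; rewrite yE linearZ /= => /eqP.
    rewrite scaler_eq0 => /orP[/eqP d0|/eqP //].
    by rewrite yE d0 scale0r eqxx in y0.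
  have [l [x1l x1l' s]] := pol1.
  have e : l = l1.
    apply: ck_level_uniq x1l x1l' _ _; first by rewrite hl.
    by rewrite memvE -Aw -memvE.
  rewrite e in s.
  (* Otherwise [A_1] is the direct sum of the line of [x1] and the polar of [x1] in [A_1]. Then [a1]
     vanishes on [A_1 = lker a0] and is a multiple of [a0]. *)
  have x11 : form l1 x1 x1 = 0.
    apply/eqP; apply: contraT => x11; case: fra; apply: lker_form_subset.
    rewrite -A0; apply/subvP => v vA.
    pose t := form l1 x1 v / form l1 x1 x1.
    have -> : (v \in lker a1) = (v - t *: x1 \in lker a1).
      by rewrite !memv_ker linearB linearZ /= a1x1 scaler0 subr0.
    apply: (subvP s); rewrite memv_cap memv_ker.
    apply/andP; split; first by rewrite hl memvB ?memvZ.
    by rewrite linearB linearZ /= /t [_ *: _]divfK ?subrr.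
  have /vlineP[d ->] : w \in <[x1]>%VS by rewrite -Aw memv_line.
  by rewrite linearZ /= polar_mapC linearZ /= x11 !scaler0.
move=> /(tangent_lineP dL)[x0 [x1 [a0 [a1 [[frx x0L x1L card] [pol0 pol1 fra [y [y0 yL a0y a1y]]]]]]]].
have [x0n x1n] : x0 != 0 /\ x1 != 0.
  by split; apply: (free_not0 frx); rewrite !inE eqxx ?orbT.
have frC : free [:: a1; a0] by rewrite free2C.
have r1 : (1 <= ck_r C)%N by have := ltn_ord l1; rewrite hl ltnS.
(* The counting condition at index 1: exactly one basis point lies in [A_1]. *)
have : ((x0 \in ck_A C 1) + (x1 \in ck_A C 1))%N = 1%N.
  by rewrite card // hL dim_vline w0.
have [x0A|x0A] := boolP (x0 \in _); have [x1A|x1A] := boolP (x1 \in _) => // _.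
- by apply: (key x1 x0 a1 a0 y).
- by apply: (key x0 x1 a0 a1 y).
Qed.


(** * Quadratic equations for the tangent lines through [z] *)

Lemma tangent_form_small_ck1 z : (\dim (ck_A C 1) < n)%N -> z \notin ck_A C 1 ->
  exists b : V -> 'Hom(V, R^o), [/\ forall x y, b x y = b y x,
    exists x y, b x y != 0, b z = 0
    & forall x, x \notin <[z]>%VS -> tangent C (<[z]> + <[x]>)%VS <-> b x x = 0].
Proof.
move=> dA zA; have zn := form0_neq0 zA.
(* [b x x] is the Gram determinant of [z] and [x], the classical equation of the tangent cone from
   [z] to [Q_0]. *)
pose f := form ord0; pose b x := f z z *: f x - f z x *: f z.
have bE x y : b x y = f z z * f x y - f z x * f z y.
  by rewrite /b add_lfunE opp_lfunE !scale_lfunE.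
exists b; split.
- by move=> x y; rewrite !bE [f y x]polar_mapC [f z x * _]mulrC.
- have [zz|zz] := eqVneq (f z z) 0.
    have /lfunPn[v] := zn; rewrite zero_lfunE => zv.
    by exists v, v; rewrite bE zz mul0r sub0r oppr_eq0 mulf_neq0.
  (* [A_1] is too small to contain the polar of [z]; a vector [v] of that polar outside [A_1]
     satisfies [b v = f z z *: f v], which is nonzero. *)
  have /subvPn[v] : ~~ (lker (f z) <= ck_A C 1)%VS.
    apply/negP => /dimvS; have := dim_lker_form zn.
    by rewrite dimvf /dim /= mul1n => -[->]; rewrite leqNgt dA.
  rewrite memv_ker => /eqP zv /form0_neq0/lfunPn[y]; rewrite zero_lfunE => vy.
  by exists v, y; rewrite bE zv mul0r subr0 mulf_neq0.
- by rewrite /b subrr.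
move=> x xz; have x0 : x != 0 by apply: contra xz => /eqP ->; rewrite mem0v.
have fr : free [:: z; x].
  rewrite free2C free2 xz; apply: contra zA => /eqP ->; exact: mem0v.
have [h|] := eqVneq ((<[z]> + <[x]>) :&: ck_A C 1)%VS 0%VS.
  by rewrite (tangent_gram fr h) bE expr2.
rewrite -vpick0; set w := vpick _ => w0.
have : w \in ((<[z]> + <[x]>) :&: ck_A C 1)%VS by exact: memv_pick.
rewrite memv_cap => /andP[wL wA].
have zL : z \in (<[z]> + <[x]>)%VS by rewrite (subvP (addvSl _ _)) ?memv_line.
have e := line_span (dim_line2 fr) zL wL (free_ck1 zA wA w0).
(* Both sides hold: the line meets [A_1], and [x] is a combination of [z] and the radical vector
   [w]. *)
rewrite [X in tangent C X]e; split=> [_|_]; last exact: tangent_small_ck1.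
have : x \in (<[z]> + <[w]>)%VS by rewrite -e (subvP (addvSr _ _)) ?memv_line.
move=> /memv_line2[c [d xE]].
have fw u : f u w = 0 by move/mem_ck1: wA; apply.
have fxy u : f u x = c * f u z by rewrite xE linearD !linearZ /= fw scaler0 addr0.
by rewrite bE !fxy [f x z]polar_mapC fxy; ring.
Qed.

(** The line from [z] to [x] meets the hyperplane [A_1] in the projection [p x] of [x] along [z], so
    the form of [Q_1] is evaluated there. *)
Lemma tangent_form_big_ck1 z : (0 < n)%N -> \dim (ck_A C 1) = n -> z \notin ck_A C 1 ->
  exists b : V -> 'Hom(V, R^o), [/\ forall x y, b x y = b y x,
    exists x y, b x y != 0, b z = 0
    & forall x, x \notin <[z]>%VS -> tangent C (<[z]> + <[x]>)%VS <-> b x x = 0].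
Proof.
move=> n0 dA zA.
(* [A_1] has positive dimension, so the flag continues past it and [Q_1] exists. *)
have r1 : (1 < (ck_r C).+1)%N.
  rewrite ltnS lt0n; apply/eqP => r0; have := ck_A_last C.
  by rewrite r0 => A0; rewrite A0 dimv0 in dA; rewrite -dA in n0.
pose l1 := Ordinal r1; have hl : l1 = 1%N :> nat by [].
pose p := daddv_pi (ck_A C 1) <[z]>%VS.
have capA : (ck_A C 1 :&: <[z]> = 0)%VS.
  by apply/eqP; rewrite -dimv_eq0 capvC dim_line_cap (negbTE zA) andbF.
have pA v : p v \in ck_A C 1 by exact: memv_pi.
have p_id v : v \in ck_A C 1 -> p v = v by exact: daddv_pi_id.
have z0 : z != 0 by apply: contra zA => /eqP ->; rewrite mem0v.
have full : (ck_A C 1 + <[z]>)%VS = fullv.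
  apply/eqP; rewrite eqEdim subvf /= dimv_disjoint_sum // dA dim_vline z0 dimvf.
  by rewrite /dim /= mul1n addn1.
have pB v : v - p v \in <[z]>%VS.
  have {1}<- : p v + daddv_pi <[z]>%VS (ck_A C 1) v = v.
    by apply: daddv_pi_add => //; rewrite full memvf.
  by rewrite addrC addKr memv_pi.
have pz : p z = 0.
  apply/eqP; rewrite -memv0 -capA memv_cap pA /=.
  by rewrite -[p z](subKr z) memvB ?memv_line.
pose f := form l1; pose b x := (f (p x) \o p)%VF.
have bE x y : b x y = f (p x) (p y) by rewrite /b comp_lfunE.
exists b; split.
- by move=> x y; rewrite !bE polar_mapC.
- have [x [y xy]] := qform_neq0 (ck_Q C l1); exists (vsval x), (vsval y).
  by rewrite bE !p_id ?subvsP // /f polar_mapE !vsvalK.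
- by apply/lfunP => v; rewrite bE pz zero_lfunE polar_mapC linear0.
move=> x xz; have px0 : p x != 0.
  by apply: contra xz => /eqP px0; have := pB x; rewrite px0 subr0.
have e : (<[z]> + <[x]> = <[z]> + <[p x]>)%VS.
  have /vlineP[c hc] := pB x.
  apply/eqP; rewrite eqEsubv !subv_add !addvSl /= -!memvE; apply/andP; split.
    have xE : x = c *: z + p x by rewrite -hc subrK.
    by rewrite [X in X \in _]xE memv_add ?memvZ ?memv_line.
  have -> : p x = - c *: z + x by rewrite scaleNr -hc opprB subrK.
  by rewrite memv_add ?memvZ ?memv_line.
by rewrite e bE; apply: tangent_big_ck1.
Qed.

End CayleyKleinLines.

(** * From the equation of the tangent lines to the quadric *)

Theorem theorem4p4 (R : realType) (n : nat) (C : cayley_klein R n)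
    (Z : proj_point 'rV[R]_n.+1) (hZ : ~ points (ck_A C 1) Z) :
  exists Q : quadric {: 'rV[R]_n.+1},
    [set X : proj_point 'rV[R]_n.+1 |
       exists L, [/\ is_line L, points L Z, tangent C L & points L X]]
    = quadric_points Q.
Proof.
have [z z0 Zz] := proj_point_line Z.
have zA : z \notin ck_A C 1 by apply/negP => /(points_line _ Zz).
have [[L0 [dL0 zL0 tL0]]|none] :=
    pselect (exists L, [/\ is_line L, points L Z & tangent C L]); last first.
  (* A definite form has no real points. *)
  have [b [bC bdef]] := exists_definite_form 'rV[R]_n.+1.
  have bn0 : exists x y, b x y != 0.
    by exists z, z; apply: contra z0 => /eqP/bdef ->.
  have [Q hQ] := quadric_of_form bC bn0.
  exists Q; apply/predeqP => X; split=> [[L [dL zL tL _]]|].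
    by case: none; exists L.
  have [x x0 Xx] := proj_point_line X.
  by move=> /(hQ _ _ Xx)/bdef x00; rewrite x00 eqxx in x0.
have n0 : (0 < n)%N.
  have := dimvS (subvf L0); rewrite dL0 dimvf /dim /= mul1n.
  by rewrite ltnS.
have [b [bC bn0 bz btan]] : exists b : 'rV[R]_n.+1 -> 'Hom('rV[R]_n.+1, R^o),
    [/\ forall x y, b x y = b y x, exists x y, b x y != 0, b z = 0
    & forall x, x \notin <[z]>%VS -> tangent C (<[z]> + <[x]>)%VS <-> b x x = 0].
  (* [A_1] lies in the polar hyperplane of [z], which leaves the two cases of the idea. *)
  have : (\dim (ck_A C 1) <= n)%N.
    have := dimvS (ck1_subset_lker C z); have := dim_lker_form (form0_neq0 zA).
    by rewrite dimvf /dim /= mul1n => -[->].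
  rewrite leq_eqVlt => /orP[/eqP|] dA.
    exact: tangent_form_big_ck1.
  exact: tangent_form_small_ck1.
have [Q hQ] := quadric_of_form bC bn0.
exists Q; apply/predeqP => X; have [x x0 Xx] := proj_point_line X.
rewrite (hQ _ _ Xx); have [/vlineP[c xE]|xz] := boolP (x \in <[z]>%VS).
  split=> _; first by rewrite xE linearZ /= bC linearZ /= bz zero_lfunE !scaler0.
  (* Here [X] is [Z], which belongs to the set because the tangent line [L0] passes through it. *)
  exists L0; split=> //; apply/(points_line _ Xx); rewrite xE memvZ //.
  exact/(points_line _ Zz).
have fr : free [:: z; x] by rewrite free2C free2 xz.
rewrite -(btan x xz); split=> [[L [dL /(points_line _ Zz) zL tL /(points_line _ Xx) xL]]|tL].
  by rewrite -(line_span dL zL xL fr).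
exists (<[z]> + <[x]>)%VS; split=> //; first exact: dim_line2.
  by apply/(points_line _ Zz); rewrite (subvP (addvSl _ _)) ?memv_line.
by apply/(points_line _ Xx); rewrite (subvP (addvSr _ _)) ?memv_line.
Qed.
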